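(* The set of quadratic $d$-numbers of the form $a+b\sqrt{N}$ with $N\in\mathbb{Z}_{\geq1}$ and $a,b\in\frac{1}{2}\mathbb{Z}_{\geq0}$ is a discrete subset of $\mathbb{R}$.
   Context: An algebraic integer $\alpha$ is a $d$-number if the ideal it generates in the ring $\mathbb{A}$ of all algebraic integers is invariant under the action of the absolute Galois group $\mathrm{Gal}(\overline{\mathbb{Q}}/\mathbb{Q})$. A quadratic $d$-number is a $d$-number lying in a quadratic field $\mathbb{Q}(\sqrt{N})$, $N$ a square-free integer; its elements are written $a+b\sqrt{N}$ with $a,b\in\frac{1}{2}\mathbb{Z}$. *)

(* Defs.v *)
From HB Require Import structures.
From mathcomp Require Import all_boot all_order all_algebra all_field.
From mathcomp Require Import all_classical all_reals all_analysis.
Import Order.TTheory GRing.Theory Num.Theory.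
Import numFieldNormedType.Exports.

Set Implicit Arguments.
Unset Strict Implicit.
Unset Printing Implicit Defensive.

Local Open Scope classical_set_scope.
Local Open Scope ring_scope.

Definition Aint_ideal (alpha : algC) : set algC :=
  [set alpha * beta | beta in [set` Aint]].

(* Every ring automorphism of algC fixes the rationals, so the bijective ring
   morphisms algC -> algC are exactly the elements of Gal(Qbar/Q). *)
Definition d_number (alpha : algC) : Prop :=
  alpha \in Aint /\
  forall s : {rmorphism algC -> algC}, bijective s ->
    s @` Aint_ideal alpha = Aint_ideal alpha.

(* 0 is not square-free here, since every d ^+ 2 divides it. *)
Definition squarefree_int (M : int) : Prop :=
  forall d : int, (d ^+ 2 %| M)%Z -> `|d| = 1.

Definition in_Qsqrt (M : int) (alpha : algC) : Prop :=
  exists p q : rat, alpha = ratr p + ratr q * sqrtC M%:~R.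

(* M = 1 is the only square-free integer for which Q(sqrt M) is not a
   quadratic field. *)
Definition quadratic_d_number (alpha : algC) : Prop :=
  d_number alpha /\
  exists M : int, [/\ squarefree_int M, M != 1 & in_Qsqrt M alpha].

Definition nonneg_half_integer (a : rat) : Prop :=
  exists m : nat, a = m%:R / 2.

(* The same number a + b * sqrt N is written once in algC, where being a
   d-number makes sense, and once in R.  The two square roots are both the
   nonnegative one, so the two expressions correspond under any embedding of
   the real elements of algC into R. *)
Definition nonneg_quadratic_d_numbers (R : realType) : set R :=
  [set x : R | exists (N : nat) (a b : rat),
    [/\ (1 <= N)%N, nonneg_half_integer a, nonneg_half_integer b,
        quadratic_d_number (ratr a + ratr b * sqrtC N%:R : algC) &
        x = ratr a + ratr b * Num.sqrt N%:R]].

(* The subspace topology on S is discrete: every point of S is isolated. *)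
Definition discrete_subset (T : topologicalType) (S : set T) : Prop :=
  S `<=` isolated S.

(* Main.v *)
Require Import Defs.
From mathcomp Require Import all_boot all_order all_algebra all_field.
From mathcomp Require Import all_classical all_reals all_analysis.
From mathcomp Require Import lra.
Import Order.TTheory GRing.Theory Num.Theory.
Import numFieldNormedType.Exports.

(** Every number [a + b * sqrt N] of the given form equals [(m + sqrt n) / 2]
with [m] and [n = (2 * b) ^+ 2 * N] natural numbers.  Since both summands are
nonnegative, an upper bound on the number bounds [m] and [n], so only finitely
many of these numbers lie below any given bound. *)

Local Open Scope classical_set_scope.
Local Open Scope ring_scope.

(** Only finitely many points of [S] other than [x] lie below [x + 1]. They form a closed set, so
    removing them from the ray below [x + 1] leaves a neighborhood of [x] meeting [S] only in
    [x]. *)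
Lemma discrete_subset_finite_lt (R : realType) (S : set R) :
  (forall B : R, finite_set (S `&` [set y | y < B])) -> discrete_subset S.
Proof.
move=> finS x Sx; split; first exact/mem_set.
have clF : closed ((S `&` [set y | y < x + 1]) `\ x).
  apply: (iffLR accessible_finite_set_closed).
    exact/hausdorff_accessible/Rhausdorff.
  exact/finite_setD/finS.
exists ([set y | y < x + 1] `&` ~` ((S `&` [set y | y < x + 1]) `\ x)).
  apply: filterI; first by apply: lt_nbhsl; rewrite ltrDl.
  by apply: open_nbhs_nbhs; split; [exact: closed_openC | case=> _; apply].
apply/seteqP; split=> [y [[yB nFy] Sy]|_ ->] /=.
  by apply: contrapT => yx; exact: nFy.
by split=> //; split; [rewrite /= ltrDl | case=> _; apply].
Qed.

Lemma finite_half_nat_plus_sqrt_lt (R : realType) (B : R) :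
  finite_set ([set (m%:R + Num.sqrt n%:R) / 2 | m in [set: nat] & n in [set: nat]]
              `&` [set y : R | y < B]).
Proof.
(* The factor 2 clears the denominator. The successor makes [k] exceed [2 * B] even for negative
   [B], where [Num.trunc] returns 0. *)
pose k := (Num.trunc (2 * B)).+1.
apply: (@sub_finite_set _ _
    [set ((m%:R : R) + Num.sqrt n%:R) / 2 | m in `I_k & n in `I_(k ^ 2)]); last first.
  by apply: finite_image2; exact: finite_II.
move=> _ [[m _ [n _ <-]] /= ltB].
have ltk : (m%:R : R) + Num.sqrt n%:R < k%:R.
  by apply: le_lt_trans (truncnS_gt (2 * B)); lra.
have m_ge0 : 0 <= m%:R :> R by exact: ler0n.
have s_ge0 : 0 <= Num.sqrt n%:R :> R by exact: sqrtr_ge0.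
exists m; first by rewrite /= -(ltr_nat R); lra.
(* As [m] is nonnegative, [sqrt n < k]; squaring gives [n < k ^ 2]. *)
exists n => //=; rewrite -(ltr_nat R) natrX -(@sqr_sqrtr R n%:R) ?ler0n//.
by rewrite ltrXn2r// ?nnegrE; lra.
Qed.

Lemma nonneg_quadratic_d_numbers_sub (R : realType) :
  @nonneg_quadratic_d_numbers R `<=`
  [set (m%:R + Num.sqrt n%:R) / 2 | m in [set: nat] & n in [set: nat]].
Proof.
move=> _ [N [_ [_ [_ [m ->] [l ->] _ ->]]]].
(* Here [b = l / 2] with [l] nonnegative, so [l] moves under the root as [l ^ 2]. *)
exists m => //; exists (l ^ 2 * N)%N => //.
rewrite natrM natrX sqrtrM ?sqr_ge0// sqrtr_sqr ger0_norm ?ler0n//.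
by rewrite !fmorph_div !rmorph_nat mulrDl mulrAC.
Qed.

Theorem theorem3p6 (R : realType) :
  discrete_subset (@nonneg_quadratic_d_numbers R).
Proof.
apply: discrete_subset_finite_lt => B.
apply: sub_finite_set (@finite_half_nat_plus_sqrt_lt R B).
by apply: setSI; exact: nonneg_quadratic_d_numbers_sub.
Qed.
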